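(* Let $d\ge2$ and let $B(|q|,\xi)=\beta(|q|)\,b(\xi)$ be a collision kernel, where $\beta:[0,\infty)\to[0,\infty)$ is nondecreasing and $b:[0,1]\to[0,\infty)$ is measurable and satisfies the cut-off assumption $\int_{\mathbb{S}^{d-1}}b(|\tilde q\cdot n|)\,dn<+\infty$ for $\tilde q\in\mathbb{S}^{d-1}$. Let $\mathcal{L}$ be the associated linear Boltzmann operator with Maxwellian background $M$ and $\mathscr{E}$ its Dirichlet form. Then there is no constant $\lambda_0>0$ such that the inequality $$\mathscr{E}\left(\sqrt{M}\sqrt{f}\right)\ \ge\ \lambda_0\,\mathcal{H}(f|M)$$ holds for all probability distributions $f$ on $\mathbb{R}^d$.
   Context: $M(v)=(2\pi\theta)^{-d/2}\exp\left(-\frac{|v-u_0|^2}{2\theta}\right)$ with $u_0\in\mathbb{R}^d$, $\theta>0$ fixed. A probability distribution is a nonnegative $f\in L^1(\mathbb{R}^d)$ with $\int f\,dv=1$, and $\mathcal{H}(f|M)=\int_{\mathbb{R}^d} f\log\frac{f}{M}\,dv\in[0,+\infty]$. For $v,v_*\in\mathbb{R}^d$, $n\in\mathbb{S}^{d-1}$ put $q=v-v_*$, $\xi=|q\cdot n|/|q|$, $v'=v-(q\cdot n)n$, $v_*'=v_*+(q\cdot n)n$. The linear Boltzmann operator is $$\mathcal{L}f(v)=\int_{\mathbb{R}^d}\int_{\mathbb{S}^{d-1}}B(|q|,\xi)\big(f(v')M(v_*')-f(v)M(v_* )\big)\,dn\,dv_*,$$ where the collision frequency $\sigma_B(v)=\int_{\mathbb{R}^d}\int_{\mathbb{S}^{d-1}}B(|q|,\xi)M(v_*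 )\,dn\,dv_*$ is assumed finite for every $v\in\mathbb{R}^d$. The operator $\mathcal{L}$ is symmetric in $L^2(\mathbb{R}^d,M^{-1}dv)$. Its Dirichlet form is $$\mathscr{E}(g)=-\int_{\mathbb{R}^d}g(v)\,\mathcal{L}g(v)\,M(v)^{-1}\,dv,$$ understood as a nonnegative quadratic form with values in $[0,+\infty]$, namely $\mathscr{E}(g)=\frac12\int\int\int B(|q|,\xi)M(v)M(v_* )\left(\frac{g(v)}{M(v)}-\frac{g(v')}{M(v')}\right)^2dn\,dv_*\,dv$. *)

(* Defs.v *)
From HB Require Import structures.
From mathcomp Require Import all_boot all_order all_algebra.
From mathcomp Require Import all_classical all_reals all_analysis.
From mathcomp Require Import measurable_realfun.

Set Implicit Arguments.
Unset Strict Implicit.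
Unset Printing Implicit Defensive.

Import Order.TTheory GRing.Theory Num.Theory.
Import numFieldNormedType.Exports.

Local Open Scope classical_set_scope.
Local Open Scope ring_scope.

(* R^d is 'rV[R]_d with the sigma-algebra generated by the coordinates, that  *)
(* is, the Borel sigma-algebra.                                               *)

Definition rV_coord (R : realType) (d : nat) (i : 'I_d) (v : 'rV[R]_d) : R :=
  v ord0 i.

Fact rV_display : measure_display. Proof. exact. Qed.

HB.instance Definition _ (R : realType) (d : nat) :=
  @isMeasurable.Build rV_display 'rV[R]_d (g_sigma_preimage (@rV_coord R d))
    (@sigma_algebra0 _ _ _) (@sigma_algebraC _ _) (@sigma_algebra_bigcup _ _ _).

Lemma measurable_rV_coord (R : realType) (d : nat) (i : 'I_d) :
  measurable_fun [set: 'rV[R]_d] (rV_coord i).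
Proof.
move=> _ Y mY; rewrite setTI; apply: sub_sigma_algebra => /=.
rewrite -bigcup_seq/=; exists i => /=; first by rewrite mem_index_enum.
by exists Y => //; rewrite setTI.
Qed.

Lemma measurable_fun_rV (R : realType) (d : nat) (disp : measure_display)
    (T : measurableType disp) (f : T -> 'rV[R]_d) :
  (forall i, measurable_fun [set: T] (rV_coord i \o f)) ->
  measurable_fun [set: T] f.
Proof.
move=> mf _ A mA; rewrite setTI.
suff : g_sigma_preimage (fun i => rV_coord i \o f) `<=` measurable.
  by apply; rewrite g_sigma_preimage_comp; exists A => //; rewrite setTI.
apply: smallest_sub; first exact: sigma_algebra_measurable.
by rewrite -bigcup_seq => B [i /= _ [C mC <-]]; exact: mf.
Qed.

(* Lebesgue measure on R^d, by induction on d: the image of the product of    *)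
(* the Lebesgue measures on R and R^d under R * R^d ~ R^(1 + d).              *)

Definition rV_cons (R : realType) (d : nat)
    (p : measurableTypeR R * 'rV[R]_d) : 'rV[R]_d.+1 :=
  row_mx (p.1%:M : 'rV[R]_1) p.2.

Lemma rV_cons0 (R : realType) (d : nat) (p : measurableTypeR R * 'rV[R]_d) :
  rV_coord ord0 (rV_cons p) = p.1.
Proof.
transitivity (row_mx (p.1%:M : 'rV[R]_1) p.2 ord0 (lshift d ord0)).
  by congr (rV_cons p _ _); apply/val_inj.
by rewrite row_mxEl mxE eqxx mulr1n.
Qed.

Lemma rV_consS (R : realType) (d : nat) (p : measurableTypeR R * 'rV[R]_d)
    (i : 'I_d) :
  rV_coord (lift ord0 i) (rV_cons p) = rV_coord i p.2.
Proof.
transitivity (row_mx (p.1%:M : 'rV[R]_1) p.2 ord0 (rshift 1 i)).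
  by congr (rV_cons p _ _); apply/val_inj.
by rewrite row_mxEr.
Qed.

Lemma measurable_rV_cons (R : realType) (d : nat) :
  measurable_fun [set: measurableTypeR R * 'rV[R]_d] (@rV_cons R d).
Proof.
apply: measurable_fun_rV => i; have [j ->|->] := unliftP ord0 i.
- rewrite (_ : _ \o _ = rV_coord j \o snd); last first.
    by apply/funext => p /=; rewrite rV_consS.
  by apply: measurableT_comp => //; exact: measurable_rV_coord.
- rewrite (_ : _ \o _ = fst); last by apply/funext => p /=; rewrite rV_cons0.
  exact: measurable_fst.
Qed.

Definition rV_uncons (R : realType) (d : nat) (v : 'rV[R]_d.+1) :
    measurableTypeR R * 'rV[R]_d :=
  (rV_coord ord0 v, \row_i rV_coord (lift ord0 i) v).

Lemma rV_consK (R : realType) (d : nat) : cancel (@rV_cons R d) (@rV_uncons R d).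
Proof.
move=> [x v]; rewrite /rV_uncons rV_cons0; congr pair.
by apply/rowP => i; rewrite mxE rV_consS.
Qed.

Lemma rV_unconsK (R : realType) (d : nat) : cancel (@rV_uncons R d) (@rV_cons R d).
Proof.
move=> v; apply/rowP => i; rewrite -!/(rV_coord _ _).
have [j ->|->] := unliftP ord0 i; last exact: rV_cons0.
by rewrite rV_consS /rV_coord mxE.
Qed.

Lemma measurable_rV_uncons (R : realType) (d : nat) :
  measurable_fun [set: 'rV[R]_d.+1] (@rV_uncons R d).
Proof.
apply: measurable_fun_pair; first exact: measurable_rV_coord.
apply: measurable_fun_rV => i.
rewrite (_ : _ \o _ = rV_coord (lift ord0 i)); first exact: measurable_rV_coord.
by apply/funext => v /=; rewrite /rV_coord mxE.
Qed.

Section lebesgue_cons.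
Context (R : realType) (d : nat)
  (mu : {sigma_finite_measure set 'rV[R]_d -> \bar R}).
Local Open Scope ereal_scope.

Definition lebesgue_cons : set 'rV[R]_d.+1 -> \bar R :=
  pushforward (@lebesgue_measure R \x mu) (@rV_cons R d).

Let lebesgue_cons0 : lebesgue_cons set0 = 0.
Proof. by rewrite /lebesgue_cons /pushforward preimage_set0 measure0. Qed.

Let measurable_preimage (A : set 'rV[R]_d.+1) :
  measurable A -> measurable (@rV_cons R d @^-1` A).
Proof. by move=> mA; rewrite -[X in measurable X]setTI; exact: measurable_rV_cons. Qed.

Let lebesgue_cons_ge0 A : 0 <= lebesgue_cons A.
Proof. by rewrite /lebesgue_cons /pushforward measure_ge0. Qed.

Let lebesgue_cons_sigma_additive : semi_sigma_additive lebesgue_cons.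
Proof.
move=> F mF tF mUF; rewrite /lebesgue_cons /pushforward preimage_bigcup.
apply: measure_semi_sigma_additive.
- by move=> n; exact: measurable_preimage.
- apply/trivIsetP => i j _ _ ij; rewrite -preimage_setI.
  by move/trivIsetP : tF => /(_ _ _ _ _ ij) ->//; rewrite preimage_set0.
- by rewrite -preimage_bigcup; exact: measurable_preimage.
Qed.

HB.instance Definition _ := isMeasure.Build _ _ _ lebesgue_cons
  lebesgue_cons0 lebesgue_cons_ge0 lebesgue_cons_sigma_additive.

Let lebesgue_cons_sigma_finite : sigma_finite setT lebesgue_cons.
Proof.
have /sigma_finiteP[F [TF ndF Foo]] := sigma_finiteT (@lebesgue_measure R).
have /sigma_finiteP[G [TG ndG Goo]] := sigma_finiteT mu.
exists (fun n => @rV_uncons R d @^-1` (F n `*` G n)) => [|n].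
  rewrite -preimage_bigcup -[LHS](preimage_setT (@rV_uncons R d)).
  congr (_ @^-1` _); rewrite -setXTT TF TG; apply/seteqP; split => -[x y] /=.
    move=> [[n _ Fnx] [k _ Gky]]; exists (maxn n k) => //; split.
    - by move: x Fnx; exact/subsetPset/ndF/leq_maxl.
    - by move: y Gky; exact/subsetPset/ndG/leq_maxr.
  by move=> [n _ [/= ? ?]]; split; exists n.
have [mF Fn] := Foo n; have [mG Gn] := Goo n.
have mFG : measurable (F n `*` G n) by exact: measurableX.
split; first by rewrite -[X in measurable X]setTI; exact: measurable_rV_uncons.
rewrite /lebesgue_cons /pushforward -comp_preimage.
rewrite (_ : _ \o _ = id); last by apply/funext => p; exact: rV_consK.
by rewrite preimage_id product_measure1E// lte_mul_pinfty// ge0_fin_numE.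
Qed.

HB.instance Definition _ := Measure_isSigmaFinite.Build _ _ _ lebesgue_cons
  lebesgue_cons_sigma_finite.

End lebesgue_cons.

Fixpoint lebesgue_rV (R : realType) (d : nat) :
    {sigma_finite_measure set 'rV[R]_d -> \bar R} :=
  if d is d'.+1 then lebesgue_cons (lebesgue_rV R d') else \d_(0 : 'rV[R]_0).

Definition dot (R : realType) (d : nat) (u v : 'rV[R]_d) : R :=
  \sum_i u ord0 i * v ord0 i.

(* Not the norm `|v| of the library, which is the sup norm. *)
Definition enorm (R : realType) (d : nat) (v : 'rV[R]_d) : R :=
  Num.sqrt (dot v v).

Definition sphere (R : realType) (d : nat) : set 'rV[R]_d :=
  [set n | enorm n = 1].
Arguments sphere : clear implicits.

Definition direction (R : realType) (d : nat) (v : 'rV[R]_d) : 'rV[R]_d :=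
  (enorm v)^-1 *: v.

Definition punctured_ball (R : realType) (d : nat) : set 'rV[R]_d :=
  [set v | 0 < enorm v <= 1].
Arguments punctured_ball : clear implicits.

Lemma measurable_dot (R : realType) (d : nat) :
  measurable_fun [set: 'rV[R]_d] (fun v => dot v v).
Proof.
apply: measurable_sum => i.
by apply: measurable_funM; exact: measurable_rV_coord.
Qed.

Lemma measurable_enorm (R : realType) (d : nat) :
  measurable_fun [set: 'rV[R]_d] (@enorm R d).
Proof.
apply: (@measurableT_comp _ _ _ _ _ _ (@Num.sqrt R)); last exact: measurable_dot.
by apply: continuous_measurable_fun; exact: sqrt_continuous.
Qed.

Lemma measurable_direction (R : realType) (d : nat) :
  measurable_fun [set: 'rV[R]_d] (@direction R d).
Proof.
apply: measurable_fun_rV => i.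
rewrite (_ : _ \o _ = fun v => enorm v `^ (- 1) * rV_coord i v); last first.
  by apply/funext => v /=; rewrite /rV_coord mxE powR_inv1 ?sqrtr_ge0.
apply: measurable_funM; last exact: measurable_rV_coord.
by apply: (measurableT_comp (measurable_powR _)); exact: measurable_enorm.
Qed.

Lemma measurable_punctured_ball (R : realType) (d : nat) :
  measurable (punctured_ball R d).
Proof.
rewrite (_ : punctured_ball R d = [set: 'rV[R]_d] `&` @enorm R d @^-1` `]0, 1]).
  by apply: measurable_enorm => //; exact: measurable_itv.
by rewrite setTI; apply/seteqP; split => v /=; rewrite in_itv.
Qed.

(* The surface measure dn on S^(d-1), as a measure on R^d carried by the      *)
(* sphere, from polar coordinates:                                            *)
(*   dn(A) = d * |{x : 0 < |x| <= 1 and x / |x| \in A}|.                       *)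
Section surface_measure.
Context (R : realType) (d : nat).
Local Open Scope ereal_scope.

Definition cone_measure : set 'rV[R]_d -> \bar R :=
  pushforward (mrestr (lebesgue_rV R d) (@measurable_punctured_ball R d))
    (@direction R d).

Let cone_measure0 : cone_measure set0 = 0.
Proof. by rewrite /cone_measure /pushforward preimage_set0 measure0. Qed.

Let cone_measure_ge0 A : 0 <= cone_measure A.
Proof. by rewrite /cone_measure /pushforward measure_ge0. Qed.

Let measurable_preimage (A : set 'rV[R]_d) :
  measurable A -> measurable (@direction R d @^-1` A).
Proof. by move=> mA; rewrite -[X in measurable X]setTI; exact: measurable_direction. Qed.

Let cone_measure_sigma_additive : semi_sigma_additive cone_measure.
Proof.
move=> F mF tF mUF; rewrite /cone_measure /pushforward preimage_bigcup.
apply: measure_semi_sigma_additive.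
- by move=> n; exact: measurable_preimage.
- apply/trivIsetP => i j _ _ ij; rewrite -preimage_setI.
  by move/trivIsetP : tF => /(_ _ _ _ _ ij) ->//; rewrite preimage_set0.
- by rewrite -preimage_bigcup; exact: measurable_preimage.
Qed.

HB.instance Definition _ := isMeasure.Build _ _ _ cone_measure
  cone_measure0 cone_measure_ge0 cone_measure_sigma_additive.

Definition surface_measure : {measure set 'rV[R]_d -> \bar R} :=
  mscale (d%:R%:nng)%R cone_measure.

End surface_measure.

Definition maxwellian (R : realType) (d : nat) (u0 : 'rV[R]_d) (theta : R)
    (v : 'rV[R]_d) : R :=
  (2 * pi * theta) `^ (- (d%:R / 2)) *
  expR (- (enorm (v - u0) ^+ 2 / (2 * theta))).

Definition is_probability_distribution (R : realType) (d : nat)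
    (f : 'rV[R]_d -> R) : Prop :=
  [/\ forall v, 0 <= f v,
      (lebesgue_rV R d).-integrable setT (EFin \o f) &
      (\int[lebesgue_rV R d]_v (f v)%:E = 1)%E].

(* As ln 0 = 0, the integrand is 0 where f vanishes. Its negative part is at  *)
(* most M, so the integral is well defined in ]-oo, +oo] when M is integrable *)
(* and positive.                                                              *)
Definition relative_entropy (R : realType) (d : nat) (f M : 'rV[R]_d -> R) :
    \bar R :=
  (\int[lebesgue_rV R d]_v (f v * ln (f v / M v))%:E)%E.

Section linear_boltzmann.
Context (R : realType) (d : nat).
Implicit Types (v vs n : 'rV[R]_d) (B : R -> R -> R) (M g : 'rV[R]_d -> R).

Definition deviation v vs n : R := `|dot (v - vs) n| / enorm (v - vs).

Definition post v vs n : 'rV[R]_d := v - dot (v - vs) n *: n.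

Definition collision_frequency B M v : \bar R :=
  (\int[lebesgue_rV R d]_vs \int[surface_measure R d]_(n in sphere R d)
    (B (enorm (v - vs)) (deviation v vs n) * M vs)%:E)%E.

(* - \int g (L g) M^-1 dv, where, with post-collisional velocities v', vs',   *)
(*   L f (v) = \int \int B (f (v') M (vs') - f (v) M (vs)) dn dvs,            *)
(* as a quadratic form with values in [0, +oo]; in this form only v' is used. *)
Definition dirichlet_form B M g : \bar R :=
  (2^-1%:E * \int[lebesgue_rV R d]_v \int[lebesgue_rV R d]_vs
    \int[surface_measure R d]_(n in sphere R d)
      (B (enorm (v - vs)) (deviation v vs n) * M v * M vs *
       (g v / M v - g (post v vs n) / M (post v vs n)) ^+ 2)%:E)%E.

End linear_boltzmann.

(* Main.v *)
(* Test the inequality on uniform densities f = 1_A / |A|. Expanding the      *)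
(* square, the Dirichlet form of sqrt(M f) is at most half the sum of a loss  *)
(* term and a gain term; both equal \int sigma_B f, because (v, vs) |-> (v',  *)
(* vs') preserves the Lebesgue measure, |q|, |q.n| and M(v) M(vs). As sigma_B *)
(* is finite everywhere, it is bounded by some K on a set of positive         *)
(* measure, and that set has subsets A of arbitrarily small positive measure. *)
(* Then the form stays below K while H(f|M) >= - ln (|A| max M) blows up.     *)

From HB Require Import structures.
Require Import Defs.
From mathcomp Require Import all_boot all_order all_algebra.
From mathcomp Require Import all_classical all_reals all_analysis.
From mathcomp Require Import measurable_realfun ring lra.

Set Implicit Arguments.
Unset Strict Implicit.
Unset Printing Implicit Defensive.

Import Order.TTheory GRing.Theory Num.Theory.
Import numFieldNormedType.Exports.

Local Open Scope classical_set_scope.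
Local Open Scope ring_scope.

Section measurability.
Context {R : realType} {d : nat} {disp : measure_display}
  {T : measurableType disp}.
Implicit Types (f g : T -> 'rV[R]_d) (h : T -> R).

(** * Measurability of vector-valued maps *)

Lemma measurable_coord f i : measurable_fun [set: T] f ->
  measurable_fun [set: T] (fun x => f x ord0 i).
Proof. by move=> mf; exact: (measurableT_comp (measurable_rV_coord i) mf). Qed.

Lemma measurable_rVD f g : measurable_fun [set: T] f ->
  measurable_fun [set: T] g -> measurable_fun [set: T] (fun x => f x + g x).
Proof.
move=> mf mg; apply: measurable_fun_rV => i.
rewrite (_ : _ \o _ = fun x => f x ord0 i + g x ord0 i).
  by apply: measurable_funD; exact: measurable_coord.
by apply/funext => x /=; rewrite /rV_coord mxE.
Qed.

Lemma measurable_rVZ h f : measurable_fun [set: T] h ->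
  measurable_fun [set: T] f -> measurable_fun [set: T] (fun x => h x *: f x).
Proof.
move=> mh mf; apply: measurable_fun_rV => i.
rewrite (_ : _ \o _ = fun x => h x * f x ord0 i).
  by apply: measurable_funM => //; exact: measurable_coord.
by apply/funext => x /=; rewrite /rV_coord mxE.
Qed.

Lemma measurable_rVN f : measurable_fun [set: T] f ->
  measurable_fun [set: T] (fun x => - f x).
Proof.
move=> mf; rewrite (_ : (fun _ => _) = fun x => (-1 : R) *: f x).
  exact: measurable_rVZ.
by apply/funext => x; rewrite scaleN1r.
Qed.

Lemma measurable_rVB f g : measurable_fun [set: T] f ->
  measurable_fun [set: T] g -> measurable_fun [set: T] (fun x => f x - g x).
Proof. by move=> mf mg; apply: measurable_rVD => //; exact: measurable_rVN. Qed.

Lemma measurable_fun_dot f g : measurable_fun [set: T] f ->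
  measurable_fun [set: T] g -> measurable_fun [set: T] (fun x => dot (f x) (g x)).
Proof.
move=> mf mg; apply: measurable_sum => i.
by apply: measurable_funM; exact: measurable_coord.
Qed.

Lemma measurable_fun_enorm f : measurable_fun [set: T] f ->
  measurable_fun [set: T] (fun x => enorm (f x)).
Proof. by move=> mf; exact: (measurableT_comp (@measurable_enorm R d) mf). Qed.

Lemma measurable_set_itv h (I : interval R) : measurable_fun [set: T] h ->
  measurable [set x | h x \in I].
Proof.
move=> mh; rewrite [X in measurable X](_ : _ = [set: T] `&` h @^-1` [set` I]).
  by apply: mh => //; exact: measurable_itv.
by rewrite setTI.
Qed.

End measurability.

(** * Translation invariance of Lebesgue measure *)

Section lebesgue_shift.
Context {R : realType}.
Local Open Scope ereal_scope.

(** The translated measure gives half-open intervals their length, which characterizes Lebesgue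
    measure. *)
Lemma lebesgue_measureD (a : R) (A : set R) : measurable A ->
  pushforward lebesgue_measure (fun x : measurableTypeR R => (x + a)%R) A
  = lebesgue_measure A.
Proof.
have m : measurable_fun [set: measurableTypeR R]
    (fun x : measurableTypeR R => (x + a)%R : measurableTypeR R).
  exact: measurable_funD.
pose f : {mfun measurableTypeR R >-> measurableTypeR R} := HB.pack
  (fun x : measurableTypeR R => (x + a)%R : measurableTypeR R)
  (isMeasurableFun.Build _ _ _ _ _ m).
move=> mA; apply/esym.
have := @lebesgue_measure_unique R (pushforward lebesgue_measure f).
apply => //= _ [[b c]] _ <-.
rewrite /pushforward (_ : _ @^-1` _ = `](b - a)%R, (c - a)%R]%classic).
  rewrite !lebesgue_measure_itv/= !lte_fin ltrD2r.
  by case: ifP => // _; rewrite -!EFinB opprD opprK addrACA addNr addr0.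
by apply/seteqP; split => x /=; rewrite !in_itv/= ltrBlDr lerBrDr.
Qed.

Lemma ge0_integral_lebesgueD (a : R) (F : measurableTypeR R -> \bar R) :
  measurable_fun setT F -> (forall x, 0 <= F x) ->
  \int[lebesgue_measure]_x F (x + a)%R = \int[lebesgue_measure]_x F x.
Proof.
move=> mF F0.
have m : measurable_fun [set: measurableTypeR R]
    (fun x : measurableTypeR R => (x + a)%R : measurableTypeR R).
  exact: measurable_funD.
transitivity (\int[pushforward lebesgue_measure
    (fun x : measurableTypeR R => (x + a)%R : measurableTypeR R)]_x F x).
  by rewrite ge0_integral_pushforward.
by apply: eq_measure_integral => A mA _; exact: lebesgue_measureD.
Qed.

Lemma ge0_integral_lebesgue_rVS d (F : 'rV[R]_d.+1 -> \bar R) :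
  measurable_fun setT F -> (forall v, 0 <= F v) ->
  \int[lebesgue_rV R d.+1]_v F v =
  \int[lebesgue_measure]_x \int[lebesgue_rV R d]_w F (rV_cons (x, w)).
Proof.
move=> mF F0; rewrite /= /lebesgue_cons ge0_integral_pushforward//.
- rewrite preimage_setT fubini_tonelli1//=.
  by apply: measurableT_comp => //; exact: measurable_rV_cons.
- exact: measurable_rV_cons.
Qed.

(** Induction on the dimension: the first coordinate is translated on the line, the remaining ones
    by the induction hypothesis. *)
Lemma ge0_integral_lebesgue_rVD d (a : 'rV[R]_d) (F : 'rV[R]_d -> \bar R) :
  measurable_fun setT F -> (forall v, 0 <= F v) ->
  \int[lebesgue_rV R d]_v F (v + a)%R = \int[lebesgue_rV R d]_v F v.
Proof.
elim: d => [|d IH] in a F * => mF F0.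
  by apply: eq_integral => v _; rewrite (thinmx0 a) addr0.
have mcons := @measurable_rV_cons R d.
have ma : measurable_fun [set: 'rV[R]_d.+1] (fun v => v + a)%R.
  exact: measurable_rVD.
rewrite !ge0_integral_lebesgue_rVS//; last exact: measurableT_comp.
have E x w : (rV_cons (x, w) + a =
    rV_cons ((x + (rV_uncons a).1)%R : measurableTypeR R, w + (rV_uncons a).2))%R.
  apply/rowP => i; rewrite mxE -!/(rV_coord _ _).
  have [j ->|->] := unliftP ord0 i; last by rewrite !rV_cons0.
  by rewrite !rV_consS /rV_coord !mxE.
under eq_integral do under eq_integral do rewrite E.
under eq_integral => x _.
  rewrite (IH _ (fun w => F (rV_cons ((x + (rV_uncons a).1)%R : measurableTypeR R, w))))//.
    over.
  exact/(measurableT_comp mF)/(measurableT_comp mcons)/pair1_measurable.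
rewrite (@ge0_integral_lebesgueD _ (fun x => \int[lebesgue_rV R d]_w F (rV_cons (x, w))))//.
- apply: (@measurable_fun_fubini_tonelli_F _ _ _ _ _ (lebesgue_rV R d) (F \o @rV_cons R d)) => //=.
  exact: measurableT_comp.
- by move=> x; exact: integral_ge0.
Qed.

End lebesgue_shift.

(** * Dot product and Euclidean norm *)

Section dot_theory.
Context {R : realType} {d : nat}.
Implicit Types (u v w : 'rV[R]_d) (a : R).

Lemma dotC u v : dot u v = dot v u.
Proof. by apply: eq_bigr => i _; rewrite mulrC. Qed.

Lemma dotDl u v w : dot (u + v) w = dot u w + dot v w.
Proof. by rewrite -big_split; apply: eq_bigr => i _; rewrite mxE mulrDl. Qed.

Lemma dotZl a u v : dot (a *: u) v = a * dot u v.
Proof. by rewrite mulr_sumr; apply: eq_bigr => i _; rewrite mxE mulrA. Qed.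

Lemma dotNl u v : dot (- u) v = - dot u v.
Proof. by rewrite -scaleN1r dotZl mulN1r. Qed.

Lemma dotDr u v w : dot u (v + w) = dot u v + dot u w.
Proof. by rewrite dotC dotDl !(dotC u). Qed.

Lemma dotZr a u v : dot u (a *: v) = a * dot u v.
Proof. by rewrite dotC dotZl dotC. Qed.

Lemma dotNr u v : dot u (- v) = - dot u v.
Proof. by rewrite dotC dotNl dotC. Qed.

Lemma dot_ge0 u : 0 <= dot u u.
Proof. by apply: sumr_ge0 => i _; rewrite -expr2 sqr_ge0. Qed.

Lemma enorm_ge0 u : 0 <= enorm u.
Proof. exact: sqrtr_ge0. Qed.

Lemma sqr_enorm u : enorm u ^+ 2 = dot u u.
Proof. by rewrite sqr_sqrtr// dot_ge0. Qed.

Lemma enormN u : enorm (- u) = enorm u.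
Proof. by rewrite /enorm dotNl dotNr opprK. Qed.

Lemma sphere_dot u : sphere R d u -> dot u u = 1.
Proof. by move=> u1; rewrite -sqr_enorm u1 expr1n. Qed.

Lemma sqr_coord_le_dot u i : u ord0 i ^+ 2 <= dot u u.
Proof.
rewrite /dot (bigD1 i)//= -expr2 lerDl.
by apply: sumr_ge0 => j _; rewrite -expr2 sqr_ge0.
Qed.

(* From [|u - (u.n) n|^2 >= 0]. *)
Lemma norm_dot_le_enorm u n : sphere R d n -> `|dot u n| <= enorm u.
Proof.
move=> /sphere_dot n1; rewrite -(@ler_pXn2r _ 2)// ?nnegrE ?enorm_ge0//.
rewrite real_normK ?num_real// sqr_enorm.
have := dot_ge0 (u - dot u n *: n).
rewrite !(dotDl, dotDr, dotNl, dotNr, dotZl, dotZr) n1 (dotC n u) => ?; nra.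
Qed.

End dot_theory.

(** * Boxes and the volume of the unit ball *)

Definition box (R : realType) d (r : R) : set 'rV[R]_d := [set v | forall i, `|v ord0 i| <= r].
Arguments box {R} d r.

Definition unit_ball (R : realType) d : set 'rV[R]_d := [set v | enorm v <= 1].
Arguments unit_ball {R} d.

Section lebesgue_ball.
Context {R : realType}.

Lemma measurable_box d r : measurable (box d r : set 'rV[R]_d).
Proof.
rewrite [X in measurable X](_ : _ =
    \bigcap_(i in [set: 'I_d]) [set v : 'rV[R]_d | v ord0 i \in `[- r, r]]).
  apply: fin_bigcap_measurable => // i _; apply: measurable_set_itv.
  exact: measurable_rV_coord.
apply/seteqP; split => v /= vr i.
  by move=> _; rewrite /= in_itv/= -ler_norml.
by have := vr i Logic.I; rewrite /= in_itv/= -ler_norml.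
Qed.

Lemma lebesgue_rV_box d (r : R) : 0 <= r ->
  lebesgue_rV R d (box d r) = ((2 * r) ^+ d)%:E.
Proof.
move=> r0; elim: d => [|d IH].
  by rewrite /= diracE mem_set// => -[].
rewrite /= /lebesgue_cons /pushforward.
rewrite (_ : _ @^-1` _ = `[- r, r] `*` box d r); last first.
  apply/seteqP; split => -[x w] /=; rewrite in_itv/= -ler_norml.
    move=> b; split; first by rewrite -[x](rV_cons0 (x, w)); exact: b.
    by move=> i; rewrite -[w _ _](rV_consS (x, w)); exact: b.
  move=> [xr wr] i; rewrite -/(rV_coord i _); have [j ->|->] := unliftP ord0 i.
    by rewrite rV_consS; exact: wr.
  by rewrite rV_cons0.
rewrite product_measure1E//; last exact: measurable_box.
rewrite [X in (_ * X)%E]IH exprS EFinM; congr (_ * _)%E.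
rewrite [LHS](lebesgue_measure_itv `[- r, r])/= lte_fin; case: ltP => h.
  by rewrite -EFinD opprK mulr_natl mulr2n.
by have -> : r = 0; [lra | rewrite mulr0].
Qed.

Lemma measurable_unit_ball d : measurable (unit_ball d : set 'rV[R]_d).
Proof.
rewrite [X in measurable X](_ : _ = [set v | enorm v \in `]-oo, 1]]).
  by apply: measurable_set_itv; exact: measurable_enorm.
by apply/seteqP; split => v /=; rewrite in_itv.
Qed.

Lemma unit_ball_sub_box d : unit_ball d `<=` box d (1 : R).
Proof.
move=> v /= v1 i; rewrite -(@ler_pXn2r _ 2)// ?nnegrE//.
rewrite real_normK ?num_real// (le_trans (sqr_coord_le_dot _ _))// -sqr_enorm.
by rewrite ler_pXn2r// ?nnegrE ?enorm_ge0.
Qed.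

(** The radius $1/(d+1)$ is positive even when $d=0$; being at most 1 it dominates its own square,
    so the squared norm is at most $d/(d+1)$. *)
Lemma box_sub_unit_ball d : box d (d.+1%:R^-1 : R) `<=` unit_ball d.
Proof.
move=> v /= vr; rewrite /unit_ball/= -(@ler_pXn2r _ 2)// ?nnegrE ?enorm_ge0//.
rewrite sqr_enorm expr1n /dot.
apply: (@le_trans _ _ (\sum_(i < d) d.+1%:R^-1)).
  apply: ler_sum => i _; have d1 : d.+1%:R^-1 <= 1 :> R.
    by rewrite invf_le1 ?ltr0n// ler1n.
  have := vr i; move: (d.+1%:R^-1) d1 (v ord0 i) => r r1 x.
  by rewrite -expr2 -[x ^+ 2]real_normK ?num_real// => xr; have := normr_ge0 x; nra.
by rewrite sumr_const card_ord -[leLHS]mulr_natl ler_pdivrMr ?ltr0n// mul1r ler_nat.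
Qed.

(** The ball lies between two boxes of positive finite volume. This makes its volume a factor that
    can be cancelled in [ge0_integral_isometry]. *)
Lemma lebesgue_rV_unit_ball d :
  exists2 c : R, 0 < c & lebesgue_rV R d (unit_ball d) = c%:E.
Proof.
have mB := @measurable_unit_ball d.
have B1 : (lebesgue_rV R d (unit_ball d) < +oo)%E.
  apply: (@le_lt_trans _ _ (lebesgue_rV R d (box d 1))).
    apply: le_measure; rewrite ?inE//; first exact: measurable_box.
    exact: unit_ball_sub_box.
  by rewrite lebesgue_rV_box// ltry.
have B0 : (0 < lebesgue_rV R d (unit_ball d))%E.
  apply: (@lt_le_trans _ _ (lebesgue_rV R d (box d d.+1%:R^-1))); last first.
    apply: le_measure; rewrite ?inE//; first exact: measurable_box.
    exact: box_sub_unit_ball.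
  by rewrite lebesgue_rV_box// lte_fin exprn_gt0// mulr_gt0// invr_gt0 ltr0n.
exists (fine (lebesgue_rV R d (unit_ball d))).
  by rewrite fine_gt0// B0.
by rewrite fineK// ge0_fin_numE.
Qed.

End lebesgue_ball.

(** * Linear isometric involutions preserve Lebesgue measure *)

Section isometry.
Context {R : realType} {d : nat}.
Local Open Scope ereal_scope.
Local Notation mu := (lebesgue_rV R d).

(* Uniqueness of Haar measure: with [phi] the indicator of the unit ball,     *)
(* which is even and invariant under [t], translation invariance and Tonelli  *)
(* give [(\int phi) (\int F (t y)) = \int_x \int_y phi x * F (t y + x) =      *)
(* \int_x F x * (\int_y phi (x - t y)) = (\int F) (\int phi)].                *)
Lemma ge0_integral_isometry (t : 'rV[R]_d -> 'rV[R]_d) (F : 'rV[R]_d -> \bar R) :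
  measurable_fun setT t -> {morph t : x y / (x + y)%R} -> involutive t ->
  (forall x, enorm (t x) = enorm x) ->
  measurable_fun setT F -> (forall v, 0 <= F v) ->
  \int[mu]_v F (t v) = \int[mu]_v F v.
Proof.
move=> mt tD tK te mF F0.
pose phi (x : 'rV[R]_d) : \bar R := (\1_(unit_ball d) x)%:E.
have mphi : measurable_fun setT phi.
  by apply/measurable_EFinP/measurable_indic; exact: measurable_unit_ball.
have phi0 x : 0 <= phi x by rewrite lee_fin.
have phiE x y : enorm x = enorm y -> phi x = phi y.
  move=> xy; rewrite /phi !indicE; congr ((nat_of_bool _)%:R%:E).
  by apply/idP/idP; rewrite !inE /unit_ball/= xy.
(* Applying [t] gives $|x-ty|=|tx-y|=|y-tx|$, so the integrand is a translate of [phi]. *)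
have phi_shift x : \int[mu]_y phi (x - t y)%R = \int[mu]_y phi y.
  rewrite -(ge0_integral_lebesgue_rVD (- t x) mphi phi0).
  apply: eq_integral => y _; apply: phiE.
  rewrite -te -[RHS]enormN -{2}[y]tK; congr enorm.
  have t0 : t 0%R = 0%R by apply: (@addrI _ (t 0%R)); rewrite -tD !addr0.
  have tN z : t (- z)%R = (- t z)%R.
    by apply: (@addrI _ (t z)); rewrite -tD !subrr t0.
  by rewrite tD tN !tK opprD opprK addrC.
have mFt : measurable_fun setT (F \o t) by exact: measurableT_comp.
have mfst := @measurable_fst _ _ 'rV[R]_d 'rV[R]_d.
have msnd := @measurable_snd _ _ 'rV[R]_d 'rV[R]_d.
have [c c0 phic] : exists2 c : R, (0 < c)%R & \int[mu]_x phi x = c%:E.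
  have [c c0 cE] := @lebesgue_rV_unit_ball R d; exists c => //.
  by rewrite integral_indic// ?setIT//; exact: measurable_unit_ball.
suff : c%:E * \int[mu]_v F (t v) = c%:E * \int[mu]_v F v.
  move=> /(congr1 (fun x => c^-1%:E * x)).
  by rewrite !muleA -EFinM mulVf ?gt_eqF// !mul1e.
rewrite -phic -ge0_integralZr//; last exact: integral_ge0.
transitivity (\int[mu]_x \int[mu]_y (phi x * F (t y + x)%R)).
  apply: eq_integral => x _; rewrite ge0_integralZl//.
  - congr (_ * _); rewrite -[LHS](ge0_integral_lebesgue_rVD (t x))//.
    by apply: eq_integral => y _ /=; rewrite tD tK.
  - by apply: (measurableT_comp mF); exact: measurable_rVD.
transitivity (\int[mu]_y \int[mu]_x (phi x * F (t y + x)%R)).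
  apply: (@fubini_tonelli _ _ _ _ _ mu mu (fun z => phi z.1 * F (t z.2 + z.1)%R)).
    apply: emeasurable_funM; first exact: measurableT_comp.
    by apply: (measurableT_comp mF); apply: measurable_rVD => //; exact: measurableT_comp.
  by move=> z; rewrite mule_ge0.
transitivity (\int[mu]_y \int[mu]_x (phi (x - t y)%R * F x)).
  apply: eq_integral => y _; rewrite -[LHS](ge0_integral_lebesgue_rVD (- t y)%R).
  - by apply: eq_integral => x _; rewrite [(t y + _)%R]addrC subrK.
  - apply: emeasurable_funM => //.
    by apply: (measurableT_comp mF); exact: measurable_rVD.
  - by move=> x; rewrite mule_ge0.
transitivity (\int[mu]_x \int[mu]_y (phi (x - t y)%R * F x)).
  apply: (@fubini_tonelli _ _ _ _ _ mu mu (fun z => phi (z.2 - t z.1)%R * F z.2)).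
    apply: emeasurable_funM; last exact: measurableT_comp.
    by apply: (measurableT_comp mphi); apply: measurable_rVB => //; exact: measurableT_comp.
  by move=> z; rewrite mule_ge0.
rewrite -ge0_integralZl//; last exact: integral_ge0.
apply: eq_integral => x _; rewrite -(phi_shift x) ge0_integralZr//.
by apply: (measurableT_comp mphi); exact: measurable_rVB.
Qed.

End isometry.

(** * Collisions preserve Lebesgue measure *)

Section collision.
Context {R : realType} {d : nat}.
Local Open Scope ereal_scope.
Local Notation mu := (lebesgue_rV R d).

(* With [vs = v - q], the collision is a translation of [vs] by [(q.n) n]     *)
(* followed by the reflection [q |-> q - 2 (q.n) n].                          *)
Lemma ge0_integral_collision (n : 'rV[R]_d) (F : 'rV[R]_d * 'rV[R]_d -> \bar R) :
  sphere R d n -> measurable_fun setT F -> (forall z, 0 <= F z) ->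
  \int[mu]_v \int[mu]_vs F (post v vs n, post vs v n) =
  \int[mu]_v \int[mu]_vs F (v, vs).
Proof.
move=> n1 mF F0; have nn := sphere_dot n1.
pose refl q : 'rV[R]_d := (q - (2 * dot q n) *: n)%R.
have mfst := @measurable_fst _ _ 'rV[R]_d 'rV[R]_d.
have msnd := @measurable_snd _ _ 'rV[R]_d 'rV[R]_d.
have mpost (f g : 'rV[R]_d * 'rV[R]_d -> 'rV[R]_d) : measurable_fun setT f ->
    measurable_fun setT g -> measurable_fun setT (fun z => post (f z) (g z) n).
  move=> mf mg; apply: measurable_rVB => //; apply: measurable_rVZ => //.
  by apply: measurable_fun_dot => //; exact: measurable_rVB.
have mrefl : measurable_fun [set: 'rV[R]_d] refl.
  apply: measurable_rVB => //; apply: measurable_rVZ => //.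
  by apply: measurable_funM => //; exact: measurable_fun_dot.
have reflD : {morph refl : x y / (x + y)%R}.
  move=> x y; rewrite /refl dotDl; apply/rowP => i; rewrite !mxE; ring.
have dot_refl x : dot (refl x) n = (- dot x n)%R.
  rewrite /refl dotDl dotNl dotZl nn; ring.
have reflK : involutive refl.
  move=> x; rewrite {1}/refl dot_refl /refl; apply/rowP => i; rewrite !mxE; ring.
have enorm_refl x : enorm (refl x) = enorm x.
  congr Num.sqrt.
  rewrite /refl !(dotDl, dotDr, dotNl, dotNr, dotZl, dotZr) nn (dotC n x); ring.
have m1 : measurable_fun setT (fun z : 'rV[R]_d * 'rV[R]_d =>
    F (post z.1 z.2 n, post z.2 z.1 n)).
  by apply: (measurableT_comp mF); apply: measurable_fun_pair; exact: mpost.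
have m2 : measurable_fun setT (fun z : 'rV[R]_d * 'rV[R]_d =>
    F (refl z.1 + z.2, z.2)%R).
  apply: (measurableT_comp mF); apply: measurable_fun_pair => //.
  by apply: measurable_rVD => //; exact: (measurableT_comp mrefl).
have m3 : measurable_fun setT (fun z : 'rV[R]_d * 'rV[R]_d =>
    F (refl z.1 + (z.2 + dot z.1 n *: n), z.2 + dot z.1 n *: n)%R).
  have ms : measurable_fun setT (fun z : 'rV[R]_d * 'rV[R]_d =>
      (z.2 + dot z.1 n *: n)%R).
    apply: measurable_rVD => //; apply: measurable_rVZ => //.
    exact: measurable_fun_dot.
  apply: (measurableT_comp mF); apply: measurable_fun_pair => //.
  by apply: measurable_rVD => //; exact: (measurableT_comp mrefl).
rewrite (@fubini_tonelli _ _ _ _ _ mu mu _ m1 (fun z => F0 _)).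
(* At fixed $v_*$, put $v=q+v_*$; then $v_*'=v_*+(q\cdot n)n$ and $v'$ is the reflected $q$ plus
   $v_*'$. *)
transitivity (\int[mu]_vs \int[mu]_q
    F (refl q + (vs + dot q n *: n), vs + dot q n *: n)%R).
  apply: eq_integral => vs _.
  rewrite -(@ge0_integral_lebesgue_rVD _ _ vs _
    (measurableT_comp m1 (pair2_measurable vs)) (fun z => F0 _)).
  apply: eq_integral => q _; congr (F (_, _)).
    by rewrite /post addrK /refl; apply/rowP => i; rewrite !mxE; ring.
  by rewrite /post opprD addrCA subrr addr0 dotNl scaleNr opprK.
rewrite -(@fubini_tonelli _ _ _ _ _ mu mu _ m3 (fun z => F0 _)).
transitivity (\int[mu]_q \int[mu]_vs F (refl q + vs, vs)%R).
  apply: eq_integral => q _.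
  apply: (ge0_integral_lebesgue_rVD (dot q n *: n)
    (F := fun vs => F (refl q + vs, vs)%R)) => //.
  exact: (measurableT_comp m2 (pair1_measurable q)).
(* Only the reflection of $q$ is left; it is removed at fixed $v_*$, after writing $v=q+v_*$ on the
   other side too. *)
rewrite (@fubini_tonelli _ _ _ _ _ mu mu _ m2 (fun z => F0 _)).
rewrite (@fubini_tonelli _ _ _ _ _ mu mu _ mF F0).
apply: eq_integral => vs _.
have mF2 := measurableT_comp mF (pair2_measurable vs).
rewrite -(@ge0_integral_lebesgue_rVD _ _ vs _ mF2 (fun z => F0 _)).
apply: (@ge0_integral_isometry _ _ _ (fun q => F (q + vs, vs)%R)) => //.
by apply: (measurableT_comp mF2); exact: measurable_rVD.
Qed.

End collision.

(** * Iterated triple integrals *)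

Section product3.
Context {R : realType} {d1 d2 d3 : measure_display} {T1 : measurableType d1}
  {T2 : measurableType d2} {T3 : measurableType d3}.
Context (m1 : {sigma_finite_measure set T1 -> \bar R})
  (m2 : {sigma_finite_measure set T2 -> \bar R})
  (m3 : {sigma_finite_measure set T3 -> \bar R}).
Local Open Scope ereal_scope.

Local Notation I3 F := (\int[m1]_x \int[m2]_y \int[m3]_z F (x, y, z)).

Implicit Types F G : T1 * T2 * T3 -> \bar R.

Lemma measurable_integral3_3 F : measurable_fun setT F -> (forall u, 0 <= F u) ->
  measurable_fun setT (fun p => \int[m3]_z F (p, z)).
Proof. by move=> mF F0; exact: measurable_fun_fubini_tonelli_F. Qed.

Lemma measurable_integral3_2 F x :
  measurable_fun setT F -> (forall u, 0 <= F u) ->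
  measurable_fun setT (fun y => \int[m3]_z F (x, y, z)).
Proof.
move=> mF F0.
exact: (measurableT_comp (measurable_integral3_3 mF F0) (pair1_measurable x)).
Qed.

Lemma measurable_integral3_1 F : measurable_fun setT F -> (forall u, 0 <= F u) ->
  measurable_fun setT (fun x => \int[m2]_y \int[m3]_z F (x, y, z)).
Proof.
move=> mF F0; apply: (@measurable_fun_fubini_tonelli_F _ _ _ _ _ m2
  (fun p => \int[m3]_z F (p, z))); first exact: measurable_integral3_3.
by move=> p; exact: integral_ge0.
Qed.

Lemma ge0_le_integral3 F G : measurable_fun setT F -> (forall u, 0 <= F u) ->
  measurable_fun setT G -> (forall u, F u <= G u) -> I3 F <= I3 G.
Proof.
move=> mF F0 mG FG; have G0 u : 0 <= G u by exact: le_trans (FG u).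
apply: ge0_le_integral => //.
- by move=> x _; apply: integral_ge0 => y _; exact: integral_ge0.
- exact: measurable_integral3_1.
- exact: measurable_integral3_1.
move=> x _; apply: ge0_le_integral => //.
- by move=> y _; exact: integral_ge0.
- exact: measurable_integral3_2.
- exact: measurable_integral3_2.
move=> y _; apply: ge0_le_integral => //.
- exact: (measurableT_comp mF (pair1_measurable (x, y))).
- exact: (measurableT_comp mG (pair1_measurable (x, y))).
Qed.

Lemma ge0_integral3D F G : measurable_fun setT F -> (forall u, 0 <= F u) ->
  measurable_fun setT G -> (forall u, 0 <= G u) ->
  \int[m1]_x \int[m2]_y \int[m3]_z (F (x, y, z) + G (x, y, z)) = I3 F + I3 G.
Proof.
move=> mF F0 mG G0.
rewrite -ge0_integralD//; last 4 first.
- by move=> x _; apply: integral_ge0 => y _; exact: integral_ge0.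
- exact: measurable_integral3_1.
- by move=> x _; apply: integral_ge0 => y _; exact: integral_ge0.
- exact: measurable_integral3_1.
apply: eq_integral => x _; rewrite -ge0_integralD//; last 4 first.
- by move=> y _; exact: integral_ge0.
- exact: measurable_integral3_2.
- by move=> y _; exact: integral_ge0.
- exact: measurable_integral3_2.
apply: eq_integral => y _; rewrite ge0_integralD//.
- exact: (measurableT_comp mF (pair1_measurable (x, y))).
- exact: (measurableT_comp mG (pair1_measurable (x, y))).
Qed.

(** Brings the angular variable outermost, so that the collision change of variables can be made at
    fixed $n$. *)
Lemma tonelli3 F : measurable_fun setT F -> (forall u, 0 <= F u) ->
  I3 F = \int[m3]_z \int[m1]_x \int[m2]_y F (x, y, z).
Proof.
move=> mF F0.
transitivity (\int[m1]_x \int[m3]_z \int[m2]_y F (x, y, z)).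
  apply: eq_integral => x _.
  apply: (@fubini_tonelli _ _ _ _ _ m2 m3 (fun u => F (x, u.1, u.2))) => //.
  apply: (measurableT_comp mF); apply: measurable_fun_pair => //.
  exact: measurable_fun_pair.
apply: (@fubini_tonelli _ _ _ _ _ m1 m3 (fun u => \int[m2]_y F (u.1, y, u.2))).
  apply: (@measurable_fun_fubini_tonelli_F _ _ _ _ _ m2
    (fun u => F (u.1.1, u.2, u.1.2))) => //.
  apply: (measurableT_comp mF); apply: measurable_fun_pair.
    apply: measurable_fun_pair => //; exact: measurableT_comp.
  exact: measurableT_comp.
by move=> u; exact: integral_ge0.
Qed.

End product3.

(** * Finiteness of the surface measure *)

Lemma surface_measure_lty (R : realType) d : (surface_measure R d setT < +oo)%E.
Proof.
rewrite /= /mscale/= /cone_measure /pushforward/= /mrestr.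
rewrite preimage_setT setTI.
rewrite lte_mul_pinfty ?lee_fin//.
apply: (@le_lt_trans _ _ (lebesgue_rV R d (box d 1))); last first.
  by rewrite lebesgue_rV_box// ltry.
apply: le_measure; rewrite ?inE//; first exact: measurable_punctured_ball.
  exact: measurable_box.
by move=> v /andP[_ v1]; exact: unit_ball_sub_box.
Qed.

(* An alias of [surface_measure R d] that can carry a finiteness instance.    *)
Definition fin_surface_measure (R : realType) d : set 'rV[R]_d -> \bar R :=
  surface_measure R d.
Arguments fin_surface_measure : clear implicits.

HB.instance Definition _ (R : realType) d :=
  Measure.copy (fin_surface_measure R d) (surface_measure R d).

HB.instance Definition _ (R : realType) d :=
  Measure_isFinite.Build _ _ _ (fin_surface_measure R d)
    (lty_fin_num_fun (surface_measure_lty R d)).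

Lemma surface_measureE (R : realType) d :
  surface_measure R d = fin_surface_measure R d.
Proof. exact: eq_measure. Qed.

Lemma measurable_sphere (R : realType) d : measurable (sphere R d).
Proof.
rewrite [X in measurable X](_ : _ = [set: 'rV[R]_d] `&` @enorm R d @^-1` [set 1]).
  by apply: measurable_enorm => //; exact: measurable_set1.
by rewrite setTI.
Qed.

(** * Subsets of small positive measure *)

Lemma measure_bigcup_gt0 disp (T : measurableType disp) (R : realType)
    (mu : {measure set T -> \bar R}) (A : set T) (F : (set T)^nat) :
  measurable A -> (forall k, measurable (F k)) -> A `<=` \bigcup_k F k ->
  (0 < mu A)%E -> exists k, (0 < mu (F k))%E.
Proof.
move=> mA mF AF A0; apply: contrapT => /forallNP F0; move: A0.
apply/negP; rewrite -leNgt.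
apply: le_trans (measure_sigma_subadditive mu mF mA AF) _.
by rewrite eseries0// => k _ _; apply/eqP; rewrite eq_le measure_ge0 andbT leNgt; exact/negP.
Qed.

Lemma lebesgue_rV_slab (R : realType) d (a b : R) : a <= b ->
  (lebesgue_rV R d.+1 (box d.+1 1 `&` [set v | v ord0 ord0 \in `[a, b]])
    <= ((b - a) * 2 ^+ d)%:E)%E.
Proof.
move=> ab; rewrite /= /lebesgue_cons /pushforward.
set P := _ @^-1` _.
have mP : measurable P.
  rewrite -[P]setTI; apply: (@measurable_rV_cons R d) => //.
  apply: measurableI; first exact: measurable_box.
  by apply: measurable_set_itv; exact: measurable_rV_coord.
apply: (@le_trans _ _ ((@lebesgue_measure R \x lebesgue_rV R d)
    (`[a, b] `*` box d 1))%E).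
  apply: le_measure; rewrite ?inE//.
    by apply: measurableX => //; exact: measurable_box.
  move=> [x w] [/= b1 xab]; split => /=.
    by rewrite -[x](rV_cons0 (x, w)).
  by move=> i; rewrite -[w _ _](rV_consS (x, w)); exact: b1.
rewrite product_measure1E//; last exact: measurable_box.
rewrite [X in (_ * X)%E](_ : _ = (2 ^+ d)%:E); last first.
  by rewrite -[2]mulr1; exact: lebesgue_rV_box.
rewrite EFinM lee_pmul2r ?lte_fin ?exprn_gt0//.
rewrite [leLHS](lebesgue_measure_itv `[a, b])/= lte_fin; case: ltP => // _.
by rewrite lee_fin subr_ge0.
Qed.

(** The box $[-1,1]^{d+1}$ is cut along its first axis into slabs of width $e/2^d$, each of volume
    at most $e$. Countably many cover [S], so one of them meets [S] in positive measure. *)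
Lemma small_positive_subset (R : realType) d (S : set 'rV[R]_d.+1) (e : R) :
  measurable S -> S `<=` box d.+1 1 -> 0 < e -> (0 < lebesgue_rV R d.+1 S)%E ->
  exists A, [/\ measurable A, A `<=` S, (0 < lebesgue_rV R d.+1 A)%E &
    (lebesgue_rV R d.+1 A <= e%:E)%E].
Proof.
move=> mS Sbox e0 S0.
pose h := e / 2 ^+ d.
have h0 : 0 < h by rewrite divr_gt0// exprn_gt0.
pose slab k := S `&` [set v | v ord0 ord0 \in `[k%:R * h - 1, k.+1%:R * h - 1]].
have mslab k : measurable (slab k).
  by apply: measurableI => //; apply: measurable_set_itv; exact: measurable_rV_coord.
have Sslab : S `<=` \bigcup_k slab k.
  move=> v Sv; have := Sbox _ Sv ord0; rewrite ler_norml => /andP[v1 _].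
  have x0 : 0 <= (v ord0 ord0 + 1) / h.
    by rewrite divr_ge0 ?(ltW h0)// -lerBlDr sub0r.
  have /andP[] := truncn_itv x0; rewrite ler_pdivlMr// ltr_pdivrMr// => lo hi.
  exists (Num.truncn ((v ord0 ord0 + 1) / h)) => //; split => //=.
  by rewrite in_itv/= lerBlDr lerBrDr lo ltW.
have [k k0] := measure_bigcup_gt0 mS mslab Sslab S0.
exists (slab k); split => //; first exact: subIsetl.
apply: (@le_trans _ _ (lebesgue_rV R d.+1 (box d.+1 1 `&`
    [set v | v ord0 ord0 \in `[k%:R * h - 1, k.+1%:R * h - 1]]))).
  apply: le_measure; rewrite ?inE//.
    apply: measurableI; first exact: measurable_box.
    by apply: measurable_set_itv; exact: measurable_rV_coord.
  exact: setSI.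
apply: le_trans (lebesgue_rV_slab _ _) _.
  by rewrite lerD2r ler_pM2r// ler_nat.
rewrite lee_fin (_ : _ - _ = h); last by rewrite -natr1; ring.
by rewrite divfK// expf_neq0.
Qed.

(** * Auxiliary facts on integrals and measurability *)

Lemma half_adde (R : realType) (x : \bar R) : (0 <= x -> 2^-1%:E * (x + x) = x)%E.
Proof.
case: x => [x _| _|//]; first by rewrite -EFinD -EFinM; congr EFin; field.
by rewrite addey// gt0_muley// lte_fin.
Qed.

Lemma integral_mkcond_indic disp (T : measurableType disp) (R : realType)
    (mu : {measure set T -> \bar R}) (D : set T) (X : T -> R) :
  (\int[mu]_(x in D) (X x)%:E = \int[mu]_x (X x * \1_D x)%:E)%E.
Proof.
rewrite integral_mkcond; apply: eq_integral => x _.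
by rewrite patchE indicE; case: ifP => _; rewrite ?mulr1 ?mulr0.
Qed.

Lemma measurable_fun_inv_ge0 disp (T : measurableType disp) (R : realType)
    (h : T -> R) : measurable_fun setT h -> (forall x, 0 <= h x) ->
  measurable_fun setT (fun x => (h x)^-1).
Proof.
move=> mh h0; rewrite (_ : (fun _ => _) = fun x => h x `^ (- 1)).
  exact: (measurableT_comp (measurable_powR _) mh).
by apply/funext => x; rewrite powR_inv1.
Qed.

Lemma measurable_fun_sqrt disp (T : measurableType disp) (R : realType)
    (h : T -> R) : measurable_fun setT h ->
  measurable_fun setT (fun x => Num.sqrt (h x)).
Proof.
move=> mh; apply: (@measurableT_comp _ _ _ _ _ _ (@Num.sqrt R)) => //.
by apply: continuous_measurable_fun; exact: sqrt_continuous.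
Qed.

(** * The Dirichlet form is bounded by the mean collision frequency *)

Section dirichlet_form_le.
Context {R : realType} {d : nat}.
Context (B : R -> R -> R) (M f : 'rV[R]_d -> R).
Context (B_ge0 : forall r x, 0 <= B r x).
Context (mB : measurable_fun [set: 'rV[R]_d * 'rV[R]_d * 'rV[R]_d]
  (fun z => B (enorm (z.1.1 - z.1.2)) (deviation z.1.1 z.1.2 z.2))).
Context (M_gt0 : forall v, 0 < M v).
Context (mM : measurable_fun setT M).
Context (M_collision : forall v vs n, sphere R d n ->
  M (post v vs n) * M (post vs v n) = M v * M vs).
Context (f_ge0 : forall v, 0 <= f v).
Context (mf : measurable_fun setT f).

Local Notation mu := (lebesgue_rV R d).
Local Notation S := (fin_surface_measure R d).
Local Notation V3 := ('rV[R]_d * 'rV[R]_d * 'rV[R]_d)%type.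

(** The indicator of the sphere is part of the kernel, so that all integrals in $n$ run over the
    whole space and Tonelli applies directly. *)
Let b (z : V3) : R :=
  B (enorm (z.1.1 - z.1.2)) (deviation z.1.1 z.1.2 z.2) * \1_(sphere R d) z.2.

Let W (z : V3) : R := b z * M z.1.1 * M z.1.2.

Let h v := f v / M v.

Let b_ge0 z : 0 <= b z. Proof. by rewrite mulr_ge0. Qed.

Let h_ge0 v : 0 <= h v. Proof. by rewrite divr_ge0// ltW. Qed.

Let W_ge0 z : 0 <= W z. Proof. by rewrite !mulr_ge0// ltW. Qed.

Let mv : measurable_fun [set: V3] (fun z => z.1.1).
Proof. exact: (measurableT_comp measurable_fst). Qed.

Let mvs : measurable_fun [set: V3] (fun z => z.1.2).
Proof. exact: (measurableT_comp measurable_snd). Qed.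

Let mn : measurable_fun [set: V3] snd.
Proof. exact: measurable_snd. Qed.

Let mb : measurable_fun setT b.
Proof.
apply: measurable_funM => //; apply: (measurableT_comp _ mn).
by apply: measurable_indic; exact: measurable_sphere.
Qed.

Let mW : measurable_fun setT W.
Proof.
apply: measurable_funM; last exact: (measurableT_comp mM mvs).
by apply: measurable_funM => //; exact: (measurableT_comp mM mv).
Qed.

Let mh : measurable_fun setT h.
Proof.
apply: measurable_funM => //.
exact: (measurable_fun_inv_ge0 mM (fun v => ltW (M_gt0 v))).
Qed.

Let mpost : measurable_fun [set: V3] (fun z => post z.1.1 z.1.2 z.2).
Proof.
apply: measurable_rVB => //; apply: measurable_rVZ => //.
by apply: measurable_fun_dot => //; exact: measurable_rVB.
Qed.

(** The relative velocity becomes $q-2(q\cdot n)n$, which has the norm of $q$ and dot product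
    $-q\cdot n$ with $n$; the product of the Maxwellians is conserved by [M_collision]. *)
Let W_collision v vs n : W (post v vs n, post vs v n, n) = W (v, vs, n).
Proof.
rewrite /W /b /= !indicE; case: (boolP (n \in _)); last by rewrite !mulr0 !mul0r.
rewrite inE => n1; rewrite !mulr1 -!mulrA M_collision//; congr (_ * _).
have nn := sphere_dot n1.
have E : post v vs n - post vs v n = v - vs - (2 * dot (v - vs) n) *: n.
  rewrite /post -[vs - v]opprB dotNl; apply/rowP => i; rewrite !mxE; ring.
have En : enorm (post v vs n - post vs v n) = enorm (v - vs).
  rewrite E; move: (v - vs) => q; congr Num.sqrt.
  rewrite !(dotDl, dotDr, dotNl, dotNr, dotZl, dotZr) nn (dotC n q); ring.
rewrite /deviation En; congr (B _ (_ / _)).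
rewrite E; move: (v - vs) => q; rewrite dotDl dotNl dotZl nn -normrN.
congr `|_|; ring.
Qed.

Local Open Scope ereal_scope.

Local Notation I3 F := (\int[mu]_v \int[mu]_vs \int[S]_n F (v, vs, n)).

Let loss (z : V3) := (W z * h z.1.1)%:E.

Let gain (z : V3) := (W z * h (post z.1.1 z.1.2 z.2))%:E.

Let mloss : measurable_fun setT loss.
Proof.
apply/measurable_EFinP/measurable_funM => //; exact: (measurableT_comp mh mv).
Qed.

Let mgain : measurable_fun setT gain.
Proof.
apply/measurable_EFinP/measurable_funM => //; exact: (measurableT_comp mh mpost).
Qed.

Let loss_ge0 z : 0 <= loss z. Proof. by rewrite lee_fin mulr_ge0. Qed.

Let gain_ge0 z : 0 <= gain z. Proof. by rewrite lee_fin mulr_ge0. Qed.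

Let k (z : V3) := (b z * M z.1.2)%:E.

Let mk : measurable_fun setT k.
Proof.
apply/measurable_EFinP/measurable_funM => //; exact: (measurableT_comp mM mvs).
Qed.

Let k_ge0 z : 0 <= k z.
Proof. by rewrite lee_fin mulr_ge0// ltW. Qed.

Let frequencyE v :
  collision_frequency B M v = \int[mu]_vs \int[S]_n k (v, vs, n).
Proof.
rewrite /collision_frequency surface_measureE.
apply: eq_integral => vs _; rewrite integral_mkcond_indic.
by apply: eq_integral => n _; rewrite /k /b /= mulrAC.
Qed.

Lemma collision_frequency_ge0 v : 0 <= collision_frequency B M v.
Proof.
by rewrite frequencyE; apply: integral_ge0 => vs _; exact: integral_ge0.
Qed.

Lemma measurable_collision_frequency :
  measurable_fun setT (collision_frequency B M).
Proof.
apply: eq_measurable_fun (measurable_integral3_1 mu S mk k_ge0) => v _.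
by rewrite frequencyE.
Qed.

Let integral_frequency :
  \int[mu]_v ((f v)%:E * collision_frequency B M v) = I3 loss.
Proof.
apply: eq_integral => v _; rewrite frequencyE.
rewrite -ge0_integralZl ?lee_fin//; last 2 first.
- exact: (measurable_integral3_2 S v mk k_ge0).
- by move=> vs _; apply: integral_ge0.
apply: eq_integral => vs _; rewrite -ge0_integralZl ?lee_fin//; last first.
  exact: (measurableT_comp mk (pair1_measurable (v, vs))).
apply: eq_integral => n _; rewrite /k /loss /W /h -EFinM /=; congr EFin.
by field; exact: lt0r_neq0.
Qed.

(** At fixed $n$, [gain] is [loss] evaluated after the collision, because [W] is invariant; the
    change of variables then equates the integrals. Off the sphere both integrands vanish. *)
Let integral_gain : I3 gain = I3 loss.
Proof.
rewrite (tonelli3 mu mu S mgain gain_ge0) (tonelli3 mu mu S mloss loss_ge0).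
apply: eq_integral => n _.
have [nS|nS] := boolP (n \in sphere R d); last first.
  apply: eq_integral => v _; apply: eq_integral => vs _.
  by rewrite /gain /loss /W /b /= !indicE (negbTE nS) !(mulr0, mul0r).
have mln := measurableT_comp mloss (pair2_measurable n).
rewrite -(@ge0_integral_collision _ _ n _ _ mln (fun u => loss_ge0 _)).
  apply: eq_integral => v _; apply: eq_integral => vs _ /=.
  by rewrite /loss /gain W_collision.
by rewrite inE in nS.
Qed.

(* [(a - b)^2 <= a^2 + b^2] for [a, b >= 0] splits the form into a loss and a *)
(* gain term, which the collision symmetry identifies.                        *)
Lemma dirichlet_form_le_frequency :
  dirichlet_form B M (fun v => Num.sqrt (M v) * Num.sqrt (f v))%R <=
  \int[mu]_v ((f v)%:E * collision_frequency B M v).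
Proof.
(* This is $\sqrt{f/M}$, whose square is the [h] of the loss and gain terms. *)
pose s v : R := (Num.sqrt (M v) * Num.sqrt (f v) / M v)%R.
have s_ge0 v : (0 <= s v)%R.
  by apply: divr_ge0; [apply: mulr_ge0; exact: sqrtr_ge0 | exact: ltW].
have s2 v : (s v ^+ 2 = h v)%R.
  rewrite /s /h expr_div_n exprMn (sqr_sqrtr (ltW (M_gt0 v))).
  rewrite (sqr_sqrtr (f_ge0 v)); field; exact: lt0r_neq0.
have ms : measurable_fun setT s.
  have mMV := measurable_fun_inv_ge0 mM (fun v => ltW (M_gt0 v)).
  apply: (measurable_funM (measurable_funM _ _) mMV); exact: measurable_fun_sqrt.
pose D (z : V3) := (W z * (s z.1.1 - s (post z.1.1 z.1.2 z.2)) ^+ 2)%:E.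
have mD : measurable_fun setT D.
  have mss : measurable_fun setT
      (fun z : V3 => s z.1.1 - s (post z.1.1 z.1.2 z.2))%R.
    exact: measurable_funB (measurableT_comp ms mv) (measurableT_comp ms mpost).
  apply/measurable_EFinP.
  apply: measurable_funM; first exact: mW.
  apply: (measurable_funX 2).
  exact: mss.
have D0 z : 0 <= D z by rewrite lee_fin; exact/mulr_ge0/sqr_ge0.
have DE : dirichlet_form B M (fun v => Num.sqrt (M v) * Num.sqrt (f v))%R =
    2^-1%:E * I3 D.
  rewrite /dirichlet_form; apply: (congr1 (mule _)).
  apply: eq_integral => v _; apply: eq_integral => vs _.
  rewrite surface_measureE integral_mkcond_indic.
  apply: eq_integral => n _.
  rewrite /D /W /b /s; apply: (congr1 EFin); rewrite /=; ring.
rewrite [leLHS]DE integral_frequency.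
have L0 : 0 <= I3 loss.
  apply: integral_ge0 => v _; apply: integral_ge0 => vs _.
  exact: integral_ge0.
(* The loss integral is half of twice itself, also when infinite; one copy is then traded for the
   gain integral. *)
rewrite -[leRHS](half_adde L0); apply: lee_wpmul2l; first by rewrite lee_fin.
rewrite -{2}integral_gain -(ge0_integral3D mu mu S mloss loss_ge0 mgain gain_ge0).
apply: (ge0_le_integral3 mu mu S mD D0 (G := fun z => loss z + gain z)).
  exact: (emeasurable_funD mloss mgain).
move=> z; rewrite -EFinD lee_fin -mulrDr; apply: ler_wpM2l; first exact: W_ge0.
rewrite -!s2.
have := s_ge0 z.1.1; have := s_ge0 (post z.1.1 z.1.2 z.2); nra.
Qed.

End dirichlet_form_le.

(** * The Maxwellian *)

Section maxwellian_theory.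
Context {R : realType} {d : nat} (u0 : 'rV[R]_d) (theta : R).
Context (theta_gt0 : 0 < theta).
Local Notation M := (maxwellian u0 theta).
Local Notation C := ((2 * pi * theta) `^ (- (d%:R / 2))).

Lemma maxwellian_cst_gt0 : 0 < C.
Proof. by rewrite powR_gt0// !mulr_gt0// pi_gt0. Qed.

Lemma maxwellian_gt0 v : 0 < M v.
Proof. by rewrite mulr_gt0// ?maxwellian_cst_gt0// expR_gt0. Qed.

Lemma maxwellian_le v : M v <= C.
Proof.
rewrite ler_piMr ?(ltW maxwellian_cst_gt0)//.
rewrite -[leRHS]expR0 ler_expR oppr_le0 divr_ge0 ?sqr_ge0//.
by rewrite mulr_ge0// ltW.
Qed.

Lemma measurable_maxwellian : measurable_fun setT M.
Proof.
apply: measurable_funM => //; apply: (measurableT_comp (@measurable_expR R)).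
apply: measurable_funN; apply: measurable_funM => //; apply: measurable_funX.
by apply: measurable_fun_enorm; exact: measurable_rVB.
Qed.

(** Conservation of kinetic energy in the frame moving with [u0]; [post] commutes with this
    translation. *)
Lemma maxwellian_collision v vs n : sphere R d n ->
  M (post v vs n) * M (post vs v n) = M v * M vs.
Proof.
move=> /sphere_dot nn; rewrite /maxwellian mulrACA -expRD [RHS]mulrACA -expRD.
congr (_ * expR _); rewrite -!opprD -!mulrDl; congr (- (_ / _)).
rewrite !sqr_enorm.
have -> : post v vs n - u0 = post (v - u0) (vs - u0) n.
  by rewrite /post addrAC opprB addrA subrK.
have -> : post vs v n - u0 = post (vs - u0) (v - u0) n.
  by rewrite /post addrAC opprB addrA subrK.
move: (v - u0) (vs - u0) => {}v {}vs; rewrite /post.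
rewrite !(dotDl, dotDr, dotNl, dotNr, dotZl, dotZr) nn !(dotC n); ring.
Qed.

End maxwellian_theory.

(** * Uniform densities and their entropy *)

Section uniform_density.
Context {R : realType} {d : nat} (A : set 'rV[R]_d) (m : R).
Context (mA : measurable A) (m_gt0 : 0 < m)
  (Am : lebesgue_rV R d A = m%:E).

Definition uniform_density (v : 'rV[R]_d) : R := \1_A v / m.
Local Notation f := uniform_density.

Lemma uniform_density_ge0 v : 0 <= f v.
Proof. by rewrite divr_ge0// ltW. Qed.

Lemma measurable_uniform_density : measurable_fun setT f.
Proof. by apply: measurable_funM => //; exact: measurable_indic. Qed.

Lemma integral_uniform_density : (\int[lebesgue_rV R d]_v (f v)%:E = 1)%E.
Proof.
under eq_integral do rewrite /uniform_density mulrC EFinM.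
rewrite ge0_integralZl_EFin//.
- rewrite integral_indic// setIT [X in (_ * X)%E]Am -EFinM mulVf//.
  exact: lt0r_neq0.
- by apply/measurable_EFinP; exact: measurable_indic.
- by rewrite invr_ge0 ltW.
Qed.

Lemma uniform_density_is_probability : is_probability_distribution f.
Proof.
split; first exact: uniform_density_ge0.
- apply/integrableP; split.
    by apply/measurable_EFinP; exact: measurable_uniform_density.
  under eq_integral do rewrite /= ger0_norm ?uniform_density_ge0//.
  by rewrite integral_uniform_density ltry.
- exact: integral_uniform_density.
Qed.

(** On [A] one has $f/M=1/(mM)\ge1/(mC)\ge e^t$, hence $tf\le f\ln(f/M)$ pointwise, both sides being
    0 off [A]. Integrating against $\int f=1$ gives the bound. *)
Lemma relative_entropy_uniform_ge (M : 'rV[R]_d -> R) (t C : R) :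
  measurable_fun setT M -> (forall v, 0 < M v) -> (forall v, M v <= C) ->
  0 <= t -> m * C <= expR (- t) ->
  (t%:E <= relative_entropy f M)%E.
Proof.
move=> mM M0 MC t0 mC.
have tf v : t * f v <= f v * ln (f v / M v).
  rewrite /uniform_density indicE; case: (v \in A); last first.
    by rewrite !(mul0r, mulr0).
  rewrite mulrC ler_wpM2l ?mul1r ?invr_ge0 ?(ltW m_gt0)//.
  rewrite -invfM lnV ?posrE ?mulr_gt0// lerNr -ler_expR lnK ?posrE ?mulr_gt0//.
  by apply: le_trans mC; rewrite ler_pM2l.
rewrite -[t%:E]mule1 -integral_uniform_density -ge0_integralZl_EFin//; last 2 first.
- by move=> v _; rewrite lee_fin uniform_density_ge0.
- by apply/measurable_EFinP; exact: measurable_uniform_density.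
apply: ge0_le_integral => //.
- by move=> v _; rewrite -EFinM lee_fin mulr_ge0// uniform_density_ge0.
- apply/measurable_EFinP/measurable_funM => //.
  exact: measurable_uniform_density.
- have mf := measurable_uniform_density.
  apply/measurable_EFinP/measurable_funM => //.
  apply: (measurableT_comp (@measurable_ln R)).
  exact: (measurable_funM mf (measurable_fun_inv_ge0 mM (fun v => ltW (M0 v)))).
- by move=> v _; rewrite -EFinM lee_fin.
Qed.

End uniform_density.

(** * Concentration where the collision frequency is bounded *)

(** Since [sigma] is finite, its sublevel sets at integer heights cover the box, so one has positive
    measure there. Its height is [K], chosen before [e]: the same bound serves for all the small
    sets. *)
Lemma small_subset_bounded (R : realType) d (sigma : 'rV[R]_d.+1 -> \bar R) :
  measurable_fun setT sigma -> (forall v, 0 <= sigma v)%E ->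
  (forall v, sigma v < +oo)%E ->
  exists2 K : R, 0 <= K & forall e : R, 0 < e ->
    exists A (m : R), [/\ measurable A, (forall v, A v -> sigma v <= K%:E)%E,
      0 < m <= e & lebesgue_rV R d.+1 A = m%:E].
Proof.
move=> msigma s0 soo.
pose S k := box d.+1 1 `&` [set v | sigma v <= k%:R%:E]%E.
have mS k : measurable (S k).
  apply: measurableI; first exact: measurable_box.
  by rewrite -[X in measurable X]setTI; exact: emeasurable_fun_infty_c.
have boxS : box d.+1 1 `<=` \bigcup_k S k.
  move=> v v1; have sfin : sigma v \is a fin_num by rewrite ge0_fin_numE.
  exists (Num.truncn (fine (sigma v))).+1 => //; split => //=.
  by rewrite -(fineK sfin) lee_fin ltW// truncnS_gt.
have box0 : (0 < lebesgue_rV R d.+1 (box d.+1 1))%E.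
  by rewrite lebesgue_rV_box// lte_fin exprn_gt0// mulr1.
have [k k0] := measure_bigcup_gt0 (@measurable_box R d.+1 1) mS boxS box0.
exists k%:R => // e e0.
have [A [mA AS A0 Ae]] := small_positive_subset (mS k) (@subIsetl _ _ _) e0 k0.
have Afin : lebesgue_rV R d.+1 A \is a fin_num.
  by rewrite ge0_fin_numE// (le_lt_trans Ae)// ltry.
exists A, (fine (lebesgue_rV R d.+1 A)); split => //; last by rewrite fineK.
  by move=> v /AS[].
rewrite fine_gt0 ?A0 ?ltey_eq ?Afin//=.
by rewrite -lee_fin fineK.
Qed.

Lemma deviation_itv (R : realType) d (v vs n : 'rV[R]_d) : sphere R d n ->
  deviation v vs n \in `[0, 1].
Proof.
move=> n1; rewrite in_itv/= divr_ge0 ?enorm_ge0//=.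
(* When $v=v_*$ the convention $0^{-1}=0$ makes the deviation 0. *)
have [q0|q0] := eqVneq (enorm (v - vs)) 0.
  by rewrite /deviation q0 invr0 mulr0.
by rewrite ler_pdivrMr ?lt0r ?q0 ?enorm_ge0// mul1r norm_dot_le_enorm.
Qed.

Theorem theorem1p3 (R : realType) (d : nat) (d_ge2 : (2 <= d)%N)
    (u0 : 'rV[R]_d) (theta : R) (theta_gt0 : 0 < theta)
    (beta b : R -> R)
    (beta_ge0 : forall r : R, 0 <= r -> 0 <= beta r)
    (beta_nondecreasing : forall r s : R, 0 <= r -> r <= s -> beta r <= beta s)
    (b_ge0 : forall x : R, 0 <= x <= 1 -> 0 <= b x)
    (b_measurable : measurable_fun (`[0, 1] : set R) b)
    (cutoff : forall q : 'rV[R]_d, sphere R d q ->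
      (\int[surface_measure R d]_(n in sphere R d) (b `|dot q n|)%:E < +oo)%E)
    (frequency_finite : forall v : 'rV[R]_d,
      (collision_frequency (fun r x => beta r * b x)%R (maxwellian u0 theta) v
        < +oo)%E) :
  let B := fun r x : R => beta r * b x in
  let M := maxwellian u0 theta in
  ~ exists lambda0 : R, 0 < lambda0 /\
      forall f : 'rV[R]_d -> R, is_probability_distribution f ->
        (lambda0%:E * relative_entropy f M
          <= dirichlet_form B M
               (fun v => Num.sqrt (M v) * Num.sqrt (f v))%R)%E.
Proof.
case: d => [//|d] in d_ge2 u0 cutoff frequency_finite *.
move=> B M [lambda0 [l0 H]].
have M0 := maxwellian_gt0 u0 theta_gt0.
have mM := measurable_maxwellian u0 theta.
rewrite -/M in M0 mM.
have [C C0 MC] : exists2 C, 0 < C & forall v, M v <= C.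
  eexists; first exact: (@maxwellian_cst_gt0 R d.+1 _ theta_gt0).
  exact: maxwellian_le.
(* [B] is unconstrained off [0, +oo[ x [0, 1], which collisions do not leave; *)
(* [B'] agrees with it there and is nonnegative and measurable everywhere.    *)
pose beta' (r : R) := beta (Num.max 0 r).
pose b' : R -> R := b \_ `[0, 1].
pose B' (r x : R) := beta' r * b' x.
have B'_ge0 r x : 0 <= B' r x.
  apply: mulr_ge0; first by apply: beta_ge0; rewrite le_max lexx.
  rewrite /b' patchE; case: ifPn => // x01; apply: b_ge0.
  by move: x01; rewrite inE/= in_itv.
have mbeta' : measurable_fun setT beta'.
  apply: nondecreasing_measurable => // r s rs.
  by apply: beta_nondecreasing; [rewrite le_max lexx | exact: le_max2].
have mb' : measurable_fun setT b'.
  exact: (measurable_restrictT b (measurable_itv _)).1 b_measurable.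
have mB' : measurable_fun [set: 'rV[R]_d.+1 * 'rV[R]_d.+1 * 'rV[R]_d.+1]
    (fun z => B' (enorm (z.1.1 - z.1.2)) (deviation z.1.1 z.1.2 z.2)).
  have mq : measurable_fun [set: 'rV[R]_d.+1 * 'rV[R]_d.+1 * 'rV[R]_d.+1]
      (fun z => z.1.1 - z.1.2).
    apply: measurable_rVB; first exact: (measurableT_comp measurable_fst).
    exact: (measurableT_comp measurable_snd).
  have mnq := measurable_fun_enorm mq.
  apply: measurable_funM; first exact: (measurableT_comp mbeta').
  apply: (measurableT_comp mb'); apply: measurable_funM.
    apply: (measurableT_comp (@normr_measurable R setT)).
    by apply: measurable_fun_dot => //; exact: measurable_snd.
  by apply: measurable_fun_inv_ge0 => // z; exact: enorm_ge0.
have BB' (v vs n : 'rV[R]_d.+1) : sphere R d.+1 n ->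
    B (enorm (v - vs)) (deviation v vs n) = B' (enorm (v - vs)) (deviation v vs n).
  move=> n1; rewrite /B /B' /beta' (max_r (enorm_ge0 _)) /b' patchE.
  by rewrite mem_set//; exact: deviation_itv.
have freqE : collision_frequency B M =1 collision_frequency B' M.
  move=> v; apply: eq_integral => vs _; apply: eq_integral => n.
  by rewrite inE => n1; rewrite BB'.
have dirE g : dirichlet_form B M g = dirichlet_form B' M g.
  apply: (congr1 (mule _)); apply: eq_integral => v _; apply: eq_integral => vs _.
  by apply: eq_integral => n; rewrite inE => n1; rewrite BB'.
have soo v : (collision_frequency B' M v < +oo)%E.
  by rewrite -freqE; exact: frequency_finite.
have s0 := collision_frequency_ge0 B'_ge0 M0.
have ms := measurable_collision_frequency B'_ge0 mB' M0 mM.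
have Mcoll v vs n (nS : sphere R d.+1 n) := maxwellian_collision u0 theta v vs nS.
have [K K0 small] := small_subset_bounded ms s0 soo.
(* Chosen so that $\lambda_0t=K+\lambda_0>K$. *)
pose t := K / lambda0 + 1.
have t0 : 0 <= t by rewrite addr_ge0// divr_ge0// ltW.
(* A set of measure $m\le e^{-t}/C$ satisfies $mC\le e^{-t}$, which forces entropy at least [t]. *)
have e0 : 0 < expR (- t) / C by rewrite divr_gt0// expR_gt0.
have [A [m [mA AK /andP[m0 me] Am]]] := small _ e0.
pose f := uniform_density A m.
have f0 := uniform_density_ge0 A m0.
have mf := measurable_uniform_density m mA.
have f1 := integral_uniform_density mA m0 Am.
have Ht : (t%:E <= relative_entropy f M)%E.
  apply: (relative_entropy_uniform_ge mA m0 Am mM M0 MC t0).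
  by rewrite -ler_pdivlMr.
have HK : (dirichlet_form B M (fun v => Num.sqrt (M v) * Num.sqrt (f v))%R
    <= K%:E)%E.
  rewrite dirE.
  apply: le_trans (dirichlet_form_le_frequency B'_ge0 mB' M0 mM Mcoll f0 mf) _.
  (* Write $K=\int Kf$ and compare pointwise: $f$ vanishes off [A], and the frequency is at most [K]
     on [A]. *)
  rewrite -[leRHS]mule1 -f1 -ge0_integralZl_EFin//; last 2 first.
  - by move=> v _; rewrite lee_fin f0.
  - exact/measurable_EFinP.
  apply: ge0_le_integral => //.
  - by move=> v _; apply: mule_ge0 => //; rewrite lee_fin f0.
  - by apply: emeasurable_funM => //; exact/measurable_EFinP.
  - by apply: emeasurable_funM => //; exact/measurable_EFinP.
  move=> v _; rewrite muleC /f /uniform_density indicE.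
  have [vA|_] := boolP (v \in A); last by rewrite mul0r !mule0.
  apply: lee_wpmul2r; first by rewrite lee_fin divr_ge0// ltW.
  by apply: AK; rewrite inE in vA.
have := H f (uniform_density_is_probability mA m0 Am).
apply/negP; rewrite -ltNge; apply: le_lt_trans HK _.
apply: (@lt_le_trans _ _ (lambda0%:E * t%:E)%E); last first.
  by apply: lee_wpmul2l => //; rewrite lee_fin ltW.
rewrite -EFinM lte_fin /t mulrDr mulr1 [lambda0 * _]mulrC divfK ?gt_eqF//.
by rewrite ltrDl.
Qed.
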